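(* The induction functor $\mathrm{Ind}_{\mathrm{tw}}:\mathrm{SVect}\to\mathrm{Rep}_{\flat,1}(\hat{\mathfrak h}_{\mathrm{tw}})$, $X\mapsto\mathrm{Ind}_{\mathrm{tw}}(X)$, $f\mapsto\mathrm{id}\otimes f$, is an equivalence of $\mathbb C$-linear categories.
   Context: All vector spaces are super vector spaces over $\mathbb C$; $\mathrm{SVect}$ is the category of super vector spaces with even linear maps. Let $\mathfrak h$ be a nonzero finite-dimensional abelian Lie superalgebra (zero bracket) with an even, non-degenerate, supersymmetric bilinear form $(-,-)$. The twisted mode algebra is $\hat{\mathfrak h}_{\mathrm{tw}}=\mathfrak h\otimes t^{1/2}\mathbb C[t^{\pm1}]\oplus\mathbb CK$ with $a_m=a\otimes t^m$, $m\in\mathbb Z+\tfrac12$, $K$ central, and $[a_m,b_n]=m\,(a,b)\,\delta_{m+n,0}K$. A $\hat{\mathfrak h}_{\mathrm{tw}}$-module $M$ is bounded below if for every $x\in M$ there is $N_x>0$ with $a^1_{m_1}\cdots a^L_{m_L}x=0$ whenever $L>0$, $a^i\in\mathfrak h$, $m_i\in\mathbb Z+\frac12$, $m_1+\dots+m_L>N_x$; $\mathrm{Rep}_{\flat,1}(\hat{\mathfrak h}_{\mathrm{tw}})$ is the category of bounded-below modules on which $K$ acts as identity, with even intertwiners. For $X\in\mathrm{SVect}$, let $\hat{\mathfrak h}_{\mathrm{tw},>0}$ (span of $a_m$, $m>0$) act by $0$ and $K$ by the identity on $X$, and $\mathrm{Ind}_{\mathrm{tw}}(X)=U(\hat{\mathfrak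 h}_{\mathrm{tw}})\otimes_{U(\hat{\mathfrak h}_{\mathrm{tw},>0}\oplus\mathbb CK)}X$. *)

(* Defs.v *)
From mathcomp Require Import all_boot all_order all_algebra.
From mathcomp Require Import complex Rstruct.
Set Implicit Arguments. Unset Strict Implicit. Unset Printing Implicit Defensive.
Import Order.TTheory GRing.Theory Num.Theory.
Local Open Scope ring_scope.

Definition CC : numClosedFieldType := complex Rdefinitions.R.

(* A super vector space is a C-vector space V together with its parity
   automorphism s (s = id on V_0, s = -id on V_1); s is a linear involution
   and V = V_0 (+) V_1 is its eigenspace decomposition. *)
Definition is_linear (U V : lmodType CC) (f : U -> V) : Prop :=
  forall (c : CC) (u v : U), f (c *: u + v) = c *: f u + f v.

Definition is_svect (V : lmodType CC) (s : V -> V) : Prop :=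
  is_linear s /\ (forall v, s (s v) = v).

Definition homog (V : lmodType CC) (s : V -> V) (p : bool) (v : V) : Prop :=
  s v = (-1) ^+ p *: v.

Definition is_even_lin (X : lmodType CC) (sX : X -> X)
  (Y : lmodType CC) (sY : Y -> Y) (f : X -> Y) : Prop :=
  is_linear f /\ (forall x, f (sX x) = sY (f x)).

(* h is a finite-dimensional super vector space (parity sH); the bracket is
   zero; B is an even, non-degenerate, supersymmetric bilinear form. *)
Definition is_super_form (H : vectType CC) (sH : H -> H) (B : H -> H -> CC)
  : Prop :=
  [/\ is_svect sH,
      (forall a : H, is_linear (B a : H -> CC^o) ) /\
      (forall b : H, is_linear ((fun a => B a b) : H -> CC^o)),
      (forall a b, B (sH a) (sH b) = B a b),
      (forall a b pa pb, homog sH pa a -> homog sH pb b ->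
          B a b = (-1) ^+ (pa && pb) * B b a) &
      (forall a, (forall b, B a b = 0) -> a = 0)].

(* The mode index m in Z + 1/2 is encoded by n : int, with m = n + 1/2. *)
Definition mode (n : int) : CC := n%:~R + 2^-1.
Definition qmode (n : int) : rat := n%:~R + 2^-1.

(* A module over hat(h)_tw on which K acts as the identity:
   a super vector space (M, sM) with operators act a n = a_{n+1/2},
   linear in a and in the vector, of parity |a|, satisfying
   [a_m, b_k] = m (a,b) delta_{m+k,0} K  (super-commutator), K = id. *)
Definition is_twmod (H : vectType CC) (sH : H -> H) (B : H -> H -> CC)
  (M : lmodType CC) (sM : M -> M) (act : H -> int -> M -> M) : Prop :=
  [/\ is_svect sM,
      (forall a n, is_linear (act a n)),
      (forall (c : CC) a b n v, act (c *: a + b) n v = c *: act a n v + act b n v),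
      (forall a n v, sM (act a n (sM v)) = act (sH a) n v) &
      (forall a b pa pb n k v, homog sH pa a -> homog sH pb b ->
         act a n (act b k v) - (-1) ^+ (pa && pb) *: act b k (act a n v)
         = (if n + k + 1 == 0 then mode n * B a b else 0) *: v)].

Definition is_twhom (H : vectType CC)
  (M : lmodType CC) (sM : M -> M) (actM : H -> int -> M -> M)
  (N : lmodType CC) (sN : N -> N) (actN : H -> int -> N -> N) (g : M -> N)
  : Prop :=
  [/\ is_linear g, (forall v, g (sM v) = sN (g v)) &
      (forall a n v, g (actM a n v) = actN a n (g v))].

(* Bounded below: for every x there is N_x > 0 such that
   a^1_{m_1} ... a^L_{m_L} x = 0 whenever L > 0 and m_1 + ... + m_L > N_x.
   The list s = [:: (a^1,m_1); ...; (a^L,m_L)] and a^L acts first. *)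
Definition apply_modes (H : vectType CC) (M : lmodType CC)
  (act : H -> int -> M -> M) (s : seq (H * int)) (x : M) : M :=
  foldr (fun p v => act p.1 p.2 v) x s.

Definition bounded_below (H : vectType CC) (M : lmodType CC)
  (act : H -> int -> M -> M) : Prop :=
  forall x : M, exists Nx : rat, 0 < Nx /\
    forall s : seq (H * int), (0 < size s)%N ->
      Nx < \sum_(p <- s) qmode p.2 -> apply_modes act s x = 0.

(* (M, iota) is "the" induced module U(hat h_tw) (x)_{U(hat h_tw,>0 + CK)} X,
   characterised by its defining universal property (Frobenius reciprocity):
   iota : X -> M is even linear, killed by all a_m with m > 0, and for every
   hat(h)_tw-module N with K = 1 and every even linear f : X -> N killed by
   the positive modes there is a unique even intertwiner g : M -> N with
   g o iota = f. *)
Definition is_induced (H : vectType CC) (sH : H -> H) (B : H -> H -> CC)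
  (X : lmodType CC) (sX : X -> X)
  (M : lmodType CC) (sM : M -> M) (actM : H -> int -> M -> M) (iota : X -> M)
  : Prop :=
  [/\ is_twmod sH B sM actM,
      is_even_lin sX sM iota,
      (forall a n x, (0 <= n)%R -> actM a n (iota x) = 0) &
      (forall (N : lmodType CC) (sN : N -> N) (actN : H -> int -> N -> N)
              (f : X -> N),
         is_twmod sH B sN actN -> is_even_lin sX sN f ->
         (forall a n x, (0 <= n)%R -> actN a n (f x) = 0) ->
         exists g : M -> N,
           [/\ is_twhom sM actM sN actN g,
               (forall x, g (iota x) = f x) &
               (forall g' : M -> N, is_twhom sM actM sN actN g' ->
                  (forall x, g' (iota x) = f x) -> forall v, g' v = g v)])].

(* Main.v *)
Require Import Defs.
From HB Require Import structures.
From mathcomp Require Import all_boot all_order all_algebra.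
From mathcomp Require Import complex Rstruct boolp functions zify.
Import Order.TTheory GRing.Theory Num.Theory.
Set Implicit Arguments.
Unset Strict Implicit.
Unset Printing Implicit Defensive.
Local Open Scope ring_scope.

(* Choose families u_j, w_j of homogeneous vectors of h of equal parity with
   a = sum_j (w_j, a) u_j = sum_j (a, u_j) w_j.  The truncated number operator
   E_K = sum_{m < K} sum_j m^-1 (u_j)_{-m} (w_j)_m lowers (raises) by one along
   annihilation (creation) modes.  If x is killed by all long or high words of
   annihilation modes, then E (E - 1) ... (E - d) x = 0 for some d, hence
   (E - 1) ... (E - d) x is singular (killed by all positive modes).  This has
   two consequences: a bounded-below module is generated by its singular
   vectors, and in a module generated by singular vectors iota X every singular
   vector lies in iota X, since (E - 1) ... (E - d) kills the image of the
   creation modes and acts on singular vectors by a nonzero scalar.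
   A module generated by an injective singular iota is then induced, as the
   submodule of M * N generated by the pairs (iota x, f x) is a graph.  For given
   X such a module exists inside the X-valued supersymmetric functions on words
   of oscillator labels, and every bounded-below module M is itself induced from
   its space of singular vectors. *)

(** * Linear maps and subspaces over the complex numbers *)

Section IsLinear.
Variables (U V : lmodType CC) (f : U -> V).
Hypothesis linf : is_linear f.

Lemma is_linearD u v : f (u + v) = f u + f v.
Proof. by have := linf 1 u v; rewrite !scale1r. Qed.

Lemma is_linear0 : f 0 = 0.
Proof. by apply: (@addrI _ (f 0)); rewrite -is_linearD !addr0. Qed.

Lemma is_linearZ c u : f (c *: u) = c *: f u.
Proof. by have := linf c u 0; rewrite is_linear0 !addr0. Qed.

Lemma is_linearB u v : f (u - v) = f u - f v.
Proof. by rewrite -scaleN1r addrC linf scaleN1r addrC. Qed.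

Lemma is_linear_sum (I : Type) (r : seq I) (F : I -> U) :
  f (\sum_(i <- r) F i) = \sum_(i <- r) f (F i).
Proof. exact: (big_morph f is_linearD is_linear0). Qed.

End IsLinear.

Section Subspace.
Variables (V : lmodType CC) (P : V -> Prop).
Hypothesis P0 : P 0.
Hypothesis Plin : forall c u v, P u -> P v -> P (c *: u + v).

Let Pb : {pred V} := fun v => `[< P v >].

Fact subspace_closed : submod_closed Pb.
Proof.
split=> [|c u v]; first exact/asboolP.
by rewrite !unfold_in => /asboolP Pu /asboolP Pv; apply/asboolP/Plin.
Qed.

HB.instance Definition _ :=
  GRing.isSubmodClosed.Build CC V Pb subspace_closed.

Record subspace := Subspace { subspace_val :> V; _ : Pb subspace_val }.

HB.instance Definition _ := [isSub for subspace_val].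
HB.instance Definition _ := [Choice of subspace by <:].
HB.instance Definition _ := [SubChoice_isSubLmodule of subspace by <:].

(** Makes a space of its own out of a linear predicate; applied to the singular vectors of a module
    and to the submodule generated by the Fock vacua. *)
Lemma subspace_exists : exists (S : lmodType CC) (i : S -> V),
  [/\ is_linear i, injective i & forall v, P v <-> exists s, i s = v].
Proof.
exists (subspace : lmodType CC), (val : subspace -> V); split.
- by move=> c u v; rewrite linearP.
- exact: val_inj.
- move=> v; split=> [Pv|[s <-]].
    by exists (@Subspace v (introT (asboolP _) Pv)).
  by apply/asboolP; exact: (valP s).
Qed.

End Subspace.

(** * Parity projections and dual families for the form *)

Section SuperForm.
Variables (H : vectType CC) (sH : H -> H) (B : H -> H -> CC).
Hypothesis formB : is_super_form sH B.

Let linsH : is_linear sH. Proof. by case: formB => -[]. Qed.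
Let sHK a : sH (sH a) = a. Proof. by case: formB => -[]. Qed.

Lemma form_linl b : is_linear ((fun a => B a b) : H -> CC^o).
Proof. by case: formB => _ []. Qed.

Lemma form_linr a : is_linear (B a : H -> CC^o).
Proof. by case: formB => _ []. Qed.

Lemma form_even a b : B (sH a) b = B a (sH b).
Proof. by case: formB => _ _ <- _ _; rewrite sHK. Qed.

Lemma form_inj a a' : (forall b, B a b = B a' b) -> a = a'.
Proof.
case: formB => _ _ _ _ nd eqB; apply/eqP; rewrite -subr_eq0; apply/eqP.
by apply: nd => b; rewrite (is_linearB (form_linl b)) eqB subrr.
Qed.

(** Moving [sH] across the form shows that [B a b] equals its own negative. *)
Lemma form_homog pa pb a b : homog sH pa a -> homog sH pb b -> pa != pb ->
  B a b = 0.
Proof.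
move=> ha hb; have := form_even a b; rewrite ha hb.
rewrite (is_linearZ (form_linl b)) (is_linearZ (form_linr a)).
rewrite /GRing.scale /=.
have Neq x : - x = x :> CC -> x = 0.
  by move/eqP; rewrite eq_sym -addr_eq0 -mulr2n mulrn_eq0 /= => /eqP.
by case: pa pb {ha hb} => [] [] //=; rewrite ?expr0 ?expr1 mul1r mulN1r;
  move=> E _; apply: Neq.
Qed.

Definition par_proj (p : bool) (a : H) : H := 2^-1 *: (a + (-1) ^+ p *: sH a).

Lemma par_proj_homog p a : homog sH p (par_proj p a).
Proof.
rewrite /homog /par_proj (is_linearZ linsH) (is_linearD linsH).
rewrite (is_linearZ linsH) sHK [RHS]scalerA mulrC -scalerA; congr (_ *: _).
by rewrite scalerDr scalerA -signr_addb addbb expr0 scale1r addrC.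
Qed.

Lemma par_projD a : par_proj false a + par_proj true a = a.
Proof.
rewrite /par_proj -scalerDr expr0 expr1 scale1r scaleN1r addrACA subrr addr0.
by rewrite -[a + a]mulr2n -[a *+ 2]scaler_nat scalerA mulVf ?scale1r // pnatr_eq0.
Qed.

Lemma par_proj_id p a : homog sH p a -> par_proj p a = a.
Proof.
rewrite /homog /par_proj => ->; rewrite scalerA -signr_addb addbb expr0 scale1r.
by rewrite -[a + a]mulr2n -[a *+ 2]scaler_nat scalerA mulVf ?scale1r // pnatr_eq0.
Qed.

Lemma par_proj_lin p : is_linear (par_proj p).
Proof.
move=> c u v; rewrite /par_proj linsH scalerA mulrC -scalerA -scalerDr.
by congr (_ *: _); rewrite !scalerDr !scalerA [_ * c]mulrC addrACA.
Qed.

Lemma form_par_proj p a b : B (par_proj p a) b = B a (par_proj p b).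
Proof.
rewrite /par_proj (is_linearZ (form_linl b)) (is_linearZ (form_linr a)).
rewrite (is_linearD (form_linl b)) (is_linearD (form_linr a)).
by rewrite (is_linearZ (form_linl b)) (is_linearZ (form_linr a)) form_even.
Qed.

(** The commutation relations are given only for homogeneous vectors; this extends their additive
    consequences to all of [H]. *)
Lemma homog_ind (Q : H -> Prop) :
  (forall p a, homog sH p a -> Q a) ->
  (forall a b, Q a -> Q b -> Q (a + b)) -> forall a, Q a.
Proof.
move=> Qh QD a; rewrite -[a]par_projD.
by apply: QD; apply: Qh; apply: par_proj_homog.
Qed.

(** For a basis [b], the endomorphism sending [a] to the sum of [B a (b j) *: b j] is injective by
    non-degeneracy, hence onto in finite dimension. The preimages [c j] of [b j] are the dual
    basis. *)
Lemma dual_bases : exists (n : nat) (b c : 'I_n -> H),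
  (forall a, a = \sum_j B (c j) a *: b j) /\
  (forall a, a = \sum_j B a (b j) *: c j).
Proof.
pose e := vbasis {:H}; pose b (j : 'I_(\dim {:H})) := e`_j.
have be a : a = \sum_j coord e j a *: b j.
  by apply: coord_vbasis; rewrite memvf.
have cb i j : coord e i (b j) = (i == j)%:R.
  by rewrite coord_free 1?eq_sym //; apply: basis_free (vbasisP _).
have linF : linear (fun a => \sum_j B a (b j) *: b j).
  move=> k u v; rewrite scaler_sumr -big_split; apply: eq_bigr => j _ /=.
  by rewrite (form_linl (b j)) scalerDl scalerA.
pose mL := GRing.isLinear.Build _ _ _ _ (fun a => \sum_j B a (b j) *: b j) linF.
pose F : {linear H -> H} := HB.pack (fun a => \sum_j B a (b j) *: b j) mL.
have coF j a : coord e j (F a) = B a (b j).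
  rewrite /= linear_sum (bigD1 j) //= linearZ /= cb eqxx mulr1 big1 ?addr0 //.
  by move=> i ij; rewrite linearZ /= cb eq_sym (negPf ij) mulr0.
have injF : lker (linfun F) == 0%VS.
  apply/lker0P => u v; rewrite !lfunE /= => Fuv; apply: form_inj => a.
  rewrite (be a) (is_linear_sum (form_linr u)) (is_linear_sum (form_linr v)).
  apply: eq_bigr => j _.
  rewrite (is_linearZ (form_linr u)) (is_linearZ (form_linr v)).
  by rewrite -!coF /= Fuv.
have [c cP] : {c & forall j, F (c j) = b j}.
  suff /choice : forall j, exists c, F c = b j by [].
  move=> j; have: b j \in limg (linfun F).
    by rewrite lker0_limgf // memvf.
  by case/memv_imgP => c _; rewrite lfunE; exists c.
have dual i j : B (c i) (b j) = (i == j)%:R by rewrite -coF cP cb eq_sym.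
have E1 a : a = \sum_j B (c j) a *: b j.
  rewrite {1}(be a); apply: eq_bigr => j _; congr (_ *: _).
  rewrite {2}(be a) (is_linear_sum (form_linr _)) (bigD1 j) //=.
  rewrite (is_linearZ (form_linr _)) dual eqxx /GRing.scale /= mulr1.
  rewrite big1 ?addr0 // => i ij.
  by rewrite (is_linearZ (form_linr _)) dual eq_sym (negPf ij) /GRing.scale /= mulr0.
exists _, b, c; split=> // a; apply: form_inj => x.
rewrite {1}(E1 x) (is_linear_sum (form_linr _)) (is_linear_sum (form_linl _)).
apply: eq_bigr => j _; rewrite (is_linearZ (form_linr _)).
by rewrite (is_linearZ (form_linl _)) /GRing.scale /= mulrC.
Qed.

(* Projecting dual bases to both parities gives homogeneous families that
   satisfy the two expansion identities; they need not be bases. *)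
Lemma dual_homog_families : exists (J : finType) (u w : J -> H) (par : J -> bool),
  [/\ (forall j, homog sH (par j) (u j)), (forall j, homog sH (par j) (w j)),
      (forall a, a = \sum_j B (w j) a *: u j) &
      (forall a, a = \sum_j B a (u j) *: w j)].
Proof.
have [n [b [c [Eb Ec]]]] := dual_bases.
exists ('I_n * bool)%type, (fun j => par_proj j.2 (b j.1)),
  (fun j => par_proj j.2 (c j.1)), snd.
split=> [j|j|a|a] /=; try exact: par_proj_homog.
- rewrite -(pair_bigA _ (fun i p => B (par_proj p (c i)) a *: par_proj p (b i))).
  rewrite exchange_big /= big_bool /= addrC -[LHS]par_projD.
  by congr (_ + _); rewrite -[LHS](par_proj_id (par_proj_homog _ _));
    rewrite {1}(Eb (par_proj _ a)) (is_linear_sum (par_proj_lin _));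
    apply: eq_bigr => i _; rewrite (is_linearZ (par_proj_lin _)) form_par_proj.
- rewrite -(pair_bigA _ (fun i p => B a (par_proj p (b i)) *: par_proj p (c i))).
  rewrite exchange_big /= big_bool /= addrC -[LHS]par_projD.
  by congr (_ + _); rewrite -[LHS](par_proj_id (par_proj_homog _ _));
    rewrite {1}(Ec (par_proj _ a)) (is_linear_sum (par_proj_lin _));
    apply: eq_bigr => i _; rewrite (is_linearZ (par_proj_lin _)) form_par_proj.
Qed.

End SuperForm.

(** * Singular vectors, words of modes and their weights *)

Definition singular (H : vectType CC) (M : lmodType CC)
  (act : H -> int -> M -> M) (v : M) : Prop := forall a (n : nat), act a n v = 0.

Inductive generated (H : vectType CC) (X M : lmodType CC)
  (act : H -> int -> M -> M) (iota : X -> M) : M -> Prop :=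
| gen_in x : generated act iota (iota x)
| gen_lin c u v : generated act iota u -> generated act iota v ->
    generated act iota (c *: u + v)
| gen_act a n v : generated act iota v -> generated act iota (act a n v).

(* The span of the words in creation modes a_{-m} of total mode d/2, applied
   to iota X. *)
Inductive creation_span (H : vectType CC) (X M : lmodType CC)
  (act : H -> int -> M -> M) (iota : X -> M) : int -> M -> Prop :=
| cs_in x : creation_span act iota 0 (iota x)
| cs_zero d : creation_span act iota d 0
| cs_lin d c u v : creation_span act iota d u -> creation_span act iota d v ->
    creation_span act iota d (c *: u + v)
| cs_act d a (n : nat) v : creation_span act iota d v ->
    creation_span act iota (d - (2 * n + 1)%:Z) (act a (Negz n) v).

(* Some bound d works for every vector of a bounded-below module; unlike
   boundedness itself this is suited to induction on d. *)
Fixpoint killed_by (H : vectType CC) (M : lmodType CC)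
  (act : H -> int -> M -> M) (d : nat) (v : M) : Prop :=
  if d is d'.+1 then
    (forall a (n : nat), killed_by act d' (act a n v)) /\
    (forall a (n : nat), (d' <= n)%N -> act a n v = 0)
  else v = 0.

Lemma mode_gt0 (n : nat) : 0 < mode n.
Proof. by rewrite /mode ltr_wpDl ?ler0n // invr_gt0 ltr0n. Qed.

(** [Negz n] is the index [- n - 1], whose mode is opposite to that of [n]. So a central term arises
    only between the annihilator [n] and the creator [Negz n]. *)
Lemma ann_ann_index (n k : nat) : (n%:Z + k%:Z + 1 == 0) = false.
Proof. lia. Qed.

Lemma cre_cre_index (n k : nat) : (Negz n + Negz k + 1 == 0) = false.
Proof. lia. Qed.

Lemma ann_cre_index (n k : nat) : (n%:Z + Negz k + 1 == 0) = (n == k).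
Proof. lia. Qed.

(** Twice the total mode, so that weights are integers. *)
Definition word_weight (H : Type) (s : seq (H * int)) : int :=
  \sum_(p <- s) (2 * p.2 + 1).

Lemma sum_qmode (H : Type) (s : seq (H * int)) :
  \sum_(p <- s) qmode p.2 = (word_weight s)%:~R / 2.
Proof.
rewrite /word_weight; elim: s => [|p s IH]; first by rewrite !big_nil mul0r.
rewrite !big_cons IH rmorphD /= mulrDl; congr (_ + _).
rewrite /qmode rmorphD rmorphM /= mulrDl mulrC mulrA mulVf ?mul1r //.
Qed.

(** * Commutation relations, boundedness and the degree of creation words *)

Section TwistedModule.
Variables (H : vectType CC) (sH : H -> H) (B : H -> H -> CC).
Hypothesis formB : is_super_form sH B.
Variables (M : lmodType CC) (sM : M -> M) (act : H -> int -> M -> M).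
Hypothesis modM : is_twmod sH B sM act.

Lemma act_lin a n : is_linear (act a n). Proof. by case: modM. Qed.

Lemma act_linl n v : is_linear (fun a => act a n v).
Proof. by case: modM => _ _ h _ _ c a b; apply: h. Qed.

Lemma parity_act a n v : sM (act a n v) = act (sH a) n (sM v).
Proof. by case: modM => -[_ sK] _ _ h _; rewrite -h sK. Qed.

Lemma parity_lin : is_linear sM. Proof. by case: modM => -[]. Qed.

Section Commutators.
Variables (pa pb : bool) (a b : H).
Hypotheses (ha : homog sH pa a) (hb : homog sH pb b).

Lemma act_comm n k v : act a n (act b k v) =
  (-1) ^+ (pa && pb) *: act b k (act a n v)
  + (if n + k + 1 == 0 then mode n * B a b else 0) *: v.
Proof.
by case: modM => _ _ _ _ /(_ a b pa pb n k v ha hb) <-; rewrite addrC subrK.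
Qed.

Lemma ann_ann (n k : nat) v : act a n (act b k v) =
  (-1) ^+ (pa && pb) *: act b k (act a n v).
Proof.
by rewrite act_comm ann_ann_index scale0r addr0.
Qed.

Lemma cre_cre (n k : nat) v : act a (Negz n) (act b (Negz k) v) =
  (-1) ^+ (pa && pb) *: act b (Negz k) (act a (Negz n) v).
Proof.
by rewrite act_comm cre_cre_index scale0r addr0.
Qed.

Lemma ann_cre (n k : nat) v : act a n (act b (Negz k) v) =
  (-1) ^+ (pa && pb) *: act b (Negz k) (act a n v)
  + (if n == k then mode n * B a b else 0) *: v.
Proof.
by rewrite act_comm ann_cre_index.
Qed.

End Commutators.

Lemma singularP v : singular act v <-> forall a (n : int), 0 <= n -> act a n v = 0.
Proof. by split=> [s a [n|n] n0|s a n]; [exact: s|by []|exact: s]. Qed.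

Lemma killed_byS d v : killed_by act d v -> killed_by act d.+1 v.
Proof.
elim: d v => [|d IH] v.
  by move=> /= ->; split=> a n; rewrite (is_linear0 (act_lin _ _)).
move=> [v1 v2]; split=> a n; first exact/IH/v1.
by move=> dn; apply: v2; apply: ltnW.
Qed.

Lemma killed_by_le d d' v : (d <= d')%N -> killed_by act d v -> killed_by act d' v.
Proof.
by move/subnK<-; elim: (d' - d)%N => //= k IH kv; apply: killed_byS; apply: IH.
Qed.

Lemma killed_by_large d v a (n : nat) : (d <= n.+1)%N -> killed_by act d v ->
  act a n v = 0.
Proof.
by case: d => [_ /= ->|d dn [_]]; [exact: (is_linear0 (act_lin _ _))|apply].
Qed.

(** Unlike in [bounded_below] the empty word counts, so a negative [N] forces [v = 0]. *)
Definition bounded_at v := exists N : int,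
  forall s, N < word_weight s -> apply_modes act s v = 0.

Lemma word_weight_rcons (s : seq (H * int)) p :
  word_weight (rcons s p) = word_weight s + (2 * p.2 + 1).
Proof. by rewrite /word_weight -cats1 big_cat /= big_seq1. Qed.

Lemma apply_modes_rcons s p v :
  apply_modes act (rcons s p) v = apply_modes act s (act p.1 p.2 v).
Proof. by rewrite /apply_modes -cats1 foldr_cat. Qed.

Lemma apply_modes_lin s : is_linear (apply_modes act s).
Proof. by elim: s => [//|p s IH] c u v /=; rewrite IH act_lin. Qed.

(** An annihilator of index [n] uses up weight [2 * n + 1], at least one, so the bound drops and
    induction on it applies. At bound zero the empty word gives [v = 0]. *)
Lemma bounded_at_killed v : bounded_at v -> exists d, killed_by act d v.
Proof.
case=> N vN; exists `|N|.+1.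
have {vN}: forall s, (`|N|.+1 : int) <= word_weight s -> apply_modes act s v = 0.
  by move=> s Ns; apply: vN; lia.
elim: `|N|.+1 v => {N} [|d IH] v vd; first by apply: (vd [::]); rewrite /word_weight big_nil.
split=> a n; last first.
  move=> dn; apply: (vd [:: (a, n : int)]).
  by rewrite /word_weight big_seq1 /=; lia.
apply: IH => s ds; rewrite -(apply_modes_rcons s (a, n : int)); apply: vd.
by rewrite word_weight_rcons /=; lia.
Qed.

Lemma bounded_below_at : bounded_below act <-> forall v, bounded_at v.
Proof.
split=> bM v.
  (* The factor 2 turns modes into weights; positivity of [N] excludes the empty word, about which
     [bounded_below] says nothing. *)
  have [N [N0 vN]] := bM v; exists (Num.ceil (2 * N)) => s Ns; apply: vN.
    case: s Ns => //; rewrite /word_weight big_nil => /ltW.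
    by rewrite leNgt ceil_gt0 mulr_gt0.
  rewrite sum_qmode ltr_pdivlMr // mulrC; apply: le_lt_trans (ceil_ge _) _.
  by rewrite ltr_int.
have [N vN] := bM v; exists (`|N| + 1)%:~R; split; first by rewrite ltr0z; lia.
move=> s _; rewrite sum_qmode ltr_pdivlMr // -[2]/(2%:~R) -intrM ltr_int => Ns.
by apply: vN; lia.
Qed.

Section Generated.
Variables (X : lmodType CC) (iota : X -> M).
Hypothesis lin_iota : is_linear iota.
Hypothesis sing_iota : forall x, singular act (iota x).

Let gen := generated act iota.
Let cs := creation_span act iota.

Lemma generated0 : gen 0.
Proof.
by rewrite -[0](subrr (iota 0)) -scaleN1r addrC; apply: gen_lin; apply: gen_in.
Qed.

Lemma generated_parity (sX : X -> X) : (forall x, iota (sX x) = sM (iota x)) ->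
  forall v, gen v -> gen (sM v).
Proof.
move=> si v; elim=> [x|c u w _ IHu _ IHw|a n w _ IH].
- by rewrite -si; apply: gen_in.
- by rewrite parity_lin; apply: gen_lin.
- by rewrite parity_act; apply: gen_act.
Qed.

Lemma creation_span_gen d v : cs d v -> gen v.
Proof.
elim=> [x|{}d|{}d c u w _ IHu _ IHw|{}d a n w _ IH].
- exact: gen_in.
- exact: generated0.
- exact: gen_lin.
- exact: gen_act.
Qed.

Lemma creation_span_eq d d' v : d = d' -> cs d v -> cs d' v.
Proof. by move->. Qed.

Lemma creation_spanD d u v : cs d u -> cs d v -> cs d (u + v).
Proof. by move=> du dv; rewrite -[u]scale1r; apply: cs_lin. Qed.

Lemma creation_spanZ d c u : cs d u -> cs d (c *: u).
Proof. by move=> du; rewrite -[_ *: _]addr0; apply: cs_lin => //; apply: cs_zero. Qed.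

(** The annihilator is moved to the right until it meets [iota x]. Each central term has lost one
    creator and one annihilator of opposite modes, so it keeps the expected degree. *)
Lemma creation_span_ann d v : cs d v ->
  forall a (n : nat), cs (d + (2 * n + 1)%:Z) (act a n v).
Proof.
elim=> [x|{}d|{}d c u w _ IHu _ IHw|{}d b k w dw IH] a n.
- by rewrite sing_iota; apply: cs_zero.
- by rewrite (is_linear0 (act_lin _ _)); apply: cs_zero.
- by rewrite act_lin; apply: cs_lin; [apply: IHu|apply: IHw].
elim/(homog_ind formB): a => [pa a ha|a a' IHa IHa']; last first.
  by rewrite (is_linearD (act_linl _ _)); apply: creation_spanD.
elim/(homog_ind formB): b => [pb b hb|b b' IHb IHb']; last first.
  rewrite (is_linearD (act_linl _ _)) (is_linearD (act_lin _ _)).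
  exact: creation_spanD.
rewrite (ann_cre ha hb); apply: cs_lin.
  have := cs_act b k (IH a n); apply: creation_span_eq; lia.
case: eqP => [->|_]; last by rewrite scale0r; apply: cs_zero.
by apply: creation_spanZ; move: dw; apply: creation_span_eq; lia.
Qed.

Lemma creation_span_act d v a n : cs d v -> cs (d + (2 * n + 1)) (act a n v).
Proof.
case: n => n dv; first by have := creation_span_ann dv a n; apply: creation_span_eq; lia.
by have := cs_act a n dv; apply: creation_span_eq; lia.
Qed.

Lemma creation_span_gt0 d v : cs d v -> 0 < d -> v = 0.
Proof.
elim=> [//|//|{}d c u w _ IHu _ IHw d0|{}d a n w _ IH d0].
  by rewrite IHu // IHw // scaler0 addr0.
by rewrite IH ?(is_linear0 (act_lin _ _)) //; lia.
Qed.

(** A word of positive weight sends [iota x] into positive degree, where the creation span is zero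
    because creators only lower the degree. Applying one more mode to a vector shifts its bound. *)
Lemma generated_bounded v : gen v -> bounded_at v.
Proof.
elim=> [x|c u w _ [N Nu] _ [N' Nw]|a n w _ [N Nw]].
- exists 0 => s s0; suff /creation_span_gt0 : cs (word_weight s) (apply_modes act s (iota x)).
    exact.
  elim: s {s0} => [|p s IH]; first by rewrite /word_weight big_nil; apply: cs_in.
  rewrite /word_weight big_cons addrC; exact: creation_span_act.
- exists (Num.max N N') => s; rewrite gt_max => /andP[sN sN'].
  by rewrite apply_modes_lin Nu // Nw // scaler0 addr0.
- exists (N - (2 * n + 1)) => s sN.
  by rewrite -(apply_modes_rcons s (a, n)); apply: Nw; rewrite word_weight_rcons /=; lia.
Qed.

Inductive sum_creation_span : M -> Prop :=
| scs_in d v : cs d v -> sum_creation_span v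
| scs_add u v : sum_creation_span u -> sum_creation_span v ->
    sum_creation_span (u + v).

(** A weak form of the Poincaré-Birkhoff-Witt theorem: the creation spans are carried into each
    other by every mode, so creators alone suffice. Sums over degrees appear since generated vectors
    need not be homogeneous. *)
Lemma generated_creation v : gen v -> sum_creation_span v.
Proof.
have sZ c u : sum_creation_span u -> sum_creation_span (c *: u).
  elim=> [d w dw|w w' _ IHw _ IHw']; last by rewrite scalerDr; apply: scs_add.
  by apply: (@scs_in d); apply: creation_spanZ.
elim=> [x|c u w _ IHu _ IHw|a n w _ IH].
- by apply: (@scs_in 0); apply: cs_in.
- by apply: scs_add => //; apply: sZ.
elim: IH => [d u du|u u' _ IHu _ IHu'].
  by apply: (@scs_in (d + (2 * n + 1))); apply: creation_span_act.
by rewrite (is_linearD (act_lin _ _)); apply: scs_add.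
Qed.

End Generated.
End TwistedModule.

(** * The truncated number operator and its polynomials *)

Section NumberOperator.
Variables (H : vectType CC) (sH : H -> H) (B : H -> H -> CC).
Hypothesis formB : is_super_form sH B.
Variables (J : finType) (u w : J -> H) (par : J -> bool).
Hypothesis hu : forall j, homog sH (par j) (u j).
Hypothesis hw : forall j, homog sH (par j) (w j).
Hypothesis uE : forall a, a = \sum_j B (w j) a *: u j.
Hypothesis wE : forall a, a = \sum_j B a (u j) *: w j.
Variables (M : lmodType CC) (sM : M -> M) (act : H -> int -> M -> M).
Hypothesis modM : is_twmod sH B sM act.

Let actL := act_lin modM.
Let actH := act_linl modM.

(** The factor [(mode n)^-1] cancels the one in the central term, so each creation mode of index
    below [K] counts for one, whatever its mode. *)
Definition number_op (K : nat) (v : M) : M :=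
  \sum_(n < K) \sum_j (mode n)^-1 *: act (u j) (Negz n) (act (w j) n v).

Local Notation E := number_op.

Lemma number_op_lin K : is_linear (E K).
Proof.
move=> c v v'; rewrite /number_op scaler_sumr -big_split; apply: eq_bigr => n _.
rewrite /= scaler_sumr -big_split; apply: eq_bigr => j _ /=.
by rewrite !actL scalerDr !scalerA [c * _]mulrC.
Qed.

Lemma sum_delta (V : lmodType CC) K n (F : 'I_K -> V) (G : V) :
  (forall k, F k = if n == k :> nat then G else 0) ->
  \sum_k F k = if (n < K)%N then G else 0.
Proof.
move=> FE; case: ltnP => nK.
  rewrite (bigD1 (Ordinal nK)) //= FE eqxx big1 ?addr0 // => k.
  by rewrite FE -val_eqE eq_sym /= => /negPf ->.
by rewrite big1 // => k _; rewrite FE; case: eqP nK (ltn_ord k) => // ->; lia.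
Qed.

(** Passing [u j] and [w j], which have equal parity, gives the same sign twice, and the signs
    cancel. The central terms with [u j] add up to [act a n v] by the expansion [wE]. *)
Lemma ann_number_op K a (n : nat) v :
  act a n (E K v) = E K (act a n v) + if (n < K)%N then act a n v else 0.
Proof.
elim/(homog_ind formB): a => [pa a ha|a a' IH IH']; last first.
  rewrite !(is_linearD (actH _ _)) IH IH' (is_linearD (number_op_lin _)) addrACA.
  by case: ltnP; rewrite ?addr0.
rewrite -(@sum_delta _ K n (fun k => if n == k then act a n v else 0)) //.
rewrite /number_op -big_split (is_linear_sum (actL _ _)).
apply: eq_bigr => k _ /=; rewrite (is_linear_sum (actL _ _)).
have -> : (if n == k then act a n v else 0) = \sum_j (mode k)^-1 *:
    ((if n == k then mode n * B a (u j) else 0) *: act (w j) k v).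
  case: eqP => [->|_]; last by rewrite big1 // => j _; rewrite scale0r scaler0.
  rewrite {1}(wE a) (is_linear_sum (actH _ _)); apply: eq_bigr => j _.
  rewrite (is_linearZ (actH _ _)) scalerA mulrA mulVf ?mul1r //.
  by rewrite gt_eqF ?mode_gt0.
rewrite -big_split; apply: eq_bigr => j _ /=.
rewrite (is_linearZ (actL _ _)) -scalerDr; congr (_ *: _).
rewrite (ann_cre modM ha (hu j)) (ann_ann modM ha (hw j)).
by rewrite (is_linearZ (actL _ _)) scalerA -signr_addb addbb scale1r.
Qed.

(** Here the central terms come from [w j] and are summed by [uE]. *)
Lemma number_op_cre K a (k : nat) v : E K (act a (Negz k) v) =
  act a (Negz k) (E K v) + if (k < K)%N then act a (Negz k) v else 0.
Proof.
elim/(homog_ind formB): a => [pa a ha|a a' IH IH']; last first.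
  rewrite !(is_linearD (actH _ _)) (is_linearD (number_op_lin _)) IH IH' addrACA.
  by case: ltnP; rewrite ?addr0.
rewrite -(@sum_delta _ K k (fun n => if k == n then act a (Negz k) v else 0)) //.
rewrite /number_op (is_linear_sum (actL _ _)) -big_split.
apply: eq_bigr => n _ /=; rewrite (is_linear_sum (actL _ _)).
have -> : (if k == n then act a (Negz k) v else 0) = \sum_j (mode n)^-1 *:
    ((if n == k :> nat then mode n * B (w j) a else 0) *: act (u j) (Negz n) v).
  rewrite eq_sym; case: eqP => [->|_]; last first.
    by rewrite big1 // => j _; rewrite scale0r scaler0.
  rewrite {1}(uE a) (is_linear_sum (actH _ _)); apply: eq_bigr => j _.
  rewrite (is_linearZ (actH _ _)) scalerA mulrA mulVf ?mul1r //.
  by rewrite gt_eqF ?mode_gt0.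
rewrite -big_split; apply: eq_bigr => j _ /=.
rewrite (is_linearZ (actL _ _)) -scalerDr; congr (_ *: _).
rewrite (ann_cre modM (hw j) ha) (is_linearD (actL _ _)) !(is_linearZ (actL _ _)).
by rewrite (cre_cre modM (hu j) ha) scalerA -signr_addb addbb scale1r.
Qed.

Lemma number_op_sing K v : singular act v -> E K v = 0.
Proof.
move=> sv; rewrite /number_op big1 // => n _; rewrite big1 // => j _.
by rewrite sv (is_linear0 (actL _ _)) scaler0.
Qed.

(* [number_prod K i d] is (E - i - d + 1) ... (E - i - 1) (E - i). *)
Fixpoint number_prod (K i d : nat) (v : M) : M :=
  if d is d'.+1 then
    E K (number_prod K i d' v) - (i + d')%:R *: number_prod K i d' v
  else v.

Lemma number_prod_lin K i d : is_linear (number_prod K i d).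
Proof.
elim: d => [//|d IH] c v v' /=; rewrite IH number_op_lin.
by rewrite !scalerDr !scalerA opprD addrACA mulrC -!scalerA scalerN.
Qed.

(** Below the truncation [act a n] turns [E] into [E + 1], hence each factor [E - i - 1] into
    [E - i]. *)
Lemma ann_number_prod K i d a (n : nat) v : (n < K)%N ->
  act a n (number_prod K i.+1 d v) = number_prod K i d (act a n v).
Proof.
move=> nK; elim: d => //= d IH.
rewrite (is_linearB (actL _ _)) (is_linearZ (actL _ _)) ann_number_op nK IH.
by rewrite addSn -[(i + d).+1%:R]natr1 scalerDl scale1r opprD [- _ - _]addrC addrA addrK.
Qed.

Lemma ann_number_prod_large K i d a (n : nat) v : (K <= n)%N ->
  act a n (number_prod K i d v) = number_prod K i d (act a n v).
Proof.
move=> nK; elim: d => //= d IH.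
rewrite (is_linearB (actL _ _)) (is_linearZ (actL _ _)) ann_number_op.
by rewrite ltnNge nK addr0 IH.
Qed.

Lemma number_prod_cre K i d a (k : nat) v : (k < K)%N ->
  number_prod K i.+1 d (act a (Negz k) v) = act a (Negz k) (number_prod K i d v).
Proof.
move=> kK; elim: d => //= d IH.
rewrite (is_linearB (actL _ _)) (is_linearZ (actL _ _)) IH number_op_cre kK.
by rewrite addSn -[(i + d).+1%:R]natr1 scalerDl scale1r opprD [- _ - _]addrC addrA addrK.
Qed.

Lemma number_prod_op K i d v :
  number_prod K i d (E K v) = E K (number_prod K i d v).
Proof.
elim: d => //= d IH; rewrite IH (is_linearB (number_op_lin _)).
by rewrite (is_linearZ (number_op_lin _)).
Qed.

(** The factors commute, so the factor [E] can be taken to the front, where its annihilators meet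
    the other factors. *)
Lemma number_prod0S K d v : number_prod K 0 d.+1 v = E K (number_prod K 1 d v).
Proof.
rewrite -number_prod_op; elim: d => [|d IH] /=.
  by rewrite scale0r subr0.
by rewrite -IH /= add0n add1n.
Qed.

(** The annihilators in the leading [E] pass through the remaining factors, shift them down by one
    and lower the bound on [v] to [d - 1]. *)
Lemma number_prod_killed K d v : (d <= K)%N -> killed_by act d v ->
  number_prod K 0 d v = 0.
Proof.
elim: d v => [//|d IH] v dK vd; rewrite number_prod0S /number_op.
rewrite big1 // => n _; rewrite big1 // => j _.
rewrite ann_number_prod // IH ?(ltnW dK) //; first by rewrite (is_linear0 (actL _ _)) scaler0.
by case: vd => h _; apply: h.
Qed.

(** The value of [(E - 1) ... (E - d)] at [E = 0]. *)
Definition number_const (d : nat) : CC := (-1) ^+ d * (d`!)%:R.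

Lemma number_const_neq0 d : number_const d != 0.
Proof. by rewrite mulf_neq0 ?signr_eq0 // pnatr_eq0 -lt0n fact_gt0. Qed.

Lemma number_constS d : number_const d.+1 = - (1 + d)%:R * number_const d.
Proof. by rewrite /number_const exprS factS natrM add1n mulN1r !mulNr mulrCA. Qed.

Lemma number_prod_sing K d v : singular act v ->
  number_prod K 1 d v = number_const d *: v.
Proof.
move=> sv; elim: d => [|d IH] /=; first by rewrite /number_const mul1r scale1r.
rewrite IH (is_linearZ (number_op_lin _)) number_op_sing // scaler0 sub0r.
by rewrite number_constS scalerA mulNr scaleNr.
Qed.

Section Singular.
Variables (X : lmodType CC) (iota : X -> M).
Hypothesis lin_iota : is_linear iota.
Hypothesis sing_iota : forall x, singular act (iota x).

(** The words without creators are collected in [x]. On [act a (Negz n) v] the product becomes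
    [E (E - 1) ... (E - d + 1)] applied to [v], which vanishes because [v] is bounded. Asking only
    that [d] be large lets finitely many words share one choice. *)
Lemma sub_number_prod v : generated act iota v ->
  exists x D, forall d, (D <= d)%N -> number_prod d 1 d (v - iota x) = 0.
Proof.
have linP := number_prod_lin.
move/(generated_creation formB modM sing_iota).
have sumP v1 v2 c :
  (exists x D, forall d, (D <= d)%N -> number_prod d 1 d (v1 - iota x) = 0) ->
  (exists x D, forall d, (D <= d)%N -> number_prod d 1 d (v2 - iota x) = 0) ->
  (exists x D, forall d, (D <= d)%N ->
     number_prod d 1 d (c *: v1 + v2 - iota x) = 0).
  move=> [x1 [D1 P1]] [x2 [D2 P2]]; exists (c *: x1 + x2), (maxn D1 D2) => d.
  rewrite geq_max => /andP[d1 d2]; rewrite lin_iota opprD addrACA -scalerBr.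
  by rewrite linP P1 // P2 // scaler0 addr0.
elim=> [d {}v|v1 v2 _ IH1 _ IH2]; last first.
  by rewrite -[v1]scale1r; apply: sumP.
have zP : exists x D, forall d, (D <= d)%N -> number_prod d 1 d (0 - iota x) = 0.
  by exists 0, 0%N => k _; rewrite (is_linear0 lin_iota) subr0 (is_linear0 (linP _ _ _)).
elim=> [x|//|{}d c v1 v2 _ IH1 _ IH2|{}d a n {}v dv _].
- by exists x, 0%N => k _; rewrite subrr (is_linear0 (linP _ _ _)).
- exact: sumP.
have [D vD] : exists D, killed_by act D v.
  apply: bounded_at_killed; apply: (generated_bounded formB modM sing_iota).
  exact: creation_span_gen dv.
(* [D] serves to kill [v], and [n.+1] puts the creator below the truncation. *)
exists 0, (maxn D n.+1) => k; rewrite geq_max => /andP[kD kn].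
rewrite (is_linear0 lin_iota) subr0 number_prod_cre // number_prod_killed //.
  by rewrite (is_linear0 (actL _ _)).
exact: (killed_by_le modM kD).
Qed.

(** The difference [v - iota x] is singular too, so the product that kills it acts on it by a
    nonzero scalar. *)
Lemma generated_singular v : generated act iota v -> singular act v ->
  exists x, v = iota x.
Proof.
case/sub_number_prod => x [D vD] sv; exists x; apply/eqP; rewrite -subr_eq0.
have := vD D (leqnn D); rewrite number_prod_sing => [/eqP|a n].
  by rewrite scaler_eq0 (negPf (number_const_neq0 _)).
by rewrite (is_linearB (actL _ _)) sv sing_iota subrr.
Qed.

End Singular.

(** Induction on [d]. The vector [z = (E - 1) ... (E - d) v] is singular, and expanding it gives a
    nonzero multiple of [v] plus terms in the span of creators applied to annihilated vectors, which
    satisfy [P]. *)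
Lemma killed_by_ind (P : M -> Prop) :
  (forall c v v', P v -> P v' -> P (c *: v + v')) ->
  (forall a n v, P v -> P (act a n v)) ->
  (forall v, singular act v -> P v) ->
  forall d v, killed_by act d v -> P v.
Proof.
move=> Plin Pact Psing.
have P0 : P 0 by apply: Psing => a n; apply: (is_linear0 (actL _ _)).
have PE K v : (forall a (n : nat), P (act a n v)) -> P (E K v).
  move=> Pv.
  have Psum (I : finType) (F : I -> M) : (forall i, P (F i)) -> P (\sum_i F i).
    move=> PF; apply: (big_ind P) => [//|x y Px Py|i _]; last exact: PF.
    by rewrite -[x]scale1r; apply: (Plin).
  apply: (Psum) => n; apply: Psum => j; rewrite -[_ *: _]addr0; apply: (Plin) => //.
  exact: Pact.
elim=> [|d IH] v; first by move=> /= ->.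
move=> vd; have Pav a (n : nat) : P (act a n v) by apply: IH; case: vd => h _; apply: h.
(* With truncation [d.+1], the annihilators beyond it commute with [E] and already kill [v]. *)
set z := number_prod d.+1 1 d v.
have sz : singular act z.
  move=> a n; case: (ltnP n d.+1) => nd.
    by rewrite ann_number_prod // number_prod_killed //; case: vd => h _; apply: h.
  rewrite ann_number_prod_large // (killed_by_large modM a (ltnW nd : d.+1 <= n.+1)%N vd).
  by rewrite (is_linear0 (number_prod_lin _ _ _)).
(* Apart from its constant term the product is a value of [E], so [PE] applies; it needs [P] only
   for the annihilated vectors, not for [v]. *)
have Pz k : P (number_prod d.+1 1 k v - number_const k *: v).
  elim: k => [|k IHk] /=.
    by rewrite /number_const mul1r scale1r subrr.
  set y := number_prod _ _ _ _ in IHk *.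
  have -> : E d.+1 y - (1 + k)%:R *: y - number_const k.+1 *: v =
      (number_const k *: E d.+1 v + E d.+1 (y - number_const k *: v))
      + (- (1 + k)%:R) *: (y - number_const k *: v).
    rewrite (is_linearB (number_op_lin _)) (is_linearZ (number_op_lin _)).
    rewrite [X in _ = X + _]addrC subrK number_constS scalerBr !scaleNr scalerA.
    by rewrite mulNr scaleNr opprK addrA.
  rewrite addrC; apply: (Plin) => //; apply: (Plin); first exact: (PE).
  by apply: PE => a n; apply: Pact.
suff -> : v = (number_const d)^-1 *: (z + (-1) *: (z - number_const d *: v)) + 0.
  apply: (Plin) => //; rewrite addrC; apply: (Plin); [exact: Pz|exact: Psing].
by rewrite addr0 scaleN1r subKr scalerA mulVf ?scale1r // number_const_neq0.
Qed.

End NumberOperator.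

(** * Universal property of modules generated by singular vectors *)

Section Universal.
Variables (H : vectType CC) (sH : H -> H) (B : H -> H -> CC).
Hypothesis formB : is_super_form sH B.

Definition act_prod (M N : lmodType CC) (actM : H -> int -> M -> M)
  (actN : H -> int -> N -> N) (a : H) (n : int) (p : M * N) : M * N :=
  (actM a n p.1, actN a n p.2).

Lemma twmod_prod (M N : lmodType CC) sM sN actM actN :
  is_twmod sH B (M := M) sM actM -> is_twmod sH B (M := N) sN actN ->
  is_twmod sH B (M := (M * N)%type) (fun p => (sM p.1, sN p.2))
    (act_prod actM actN).
Proof.
move=> [[sl sK] L1 L2 Ls Lc] [[sl' sK'] L1' L2' Ls' Lc']; split.
- split=> [c p q|[p q] /=]; last by rewrite sK sK'.
  by congr pair => /=; rewrite ?sl ?sl'.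
- by move=> a n c p q; congr pair => /=; rewrite ?L1 ?L1'.
- by move=> c a b n p; congr pair => /=; rewrite ?L2 ?L2'.
- by move=> a n p; congr pair => /=; rewrite ?Ls ?Ls'.
- move=> a b pa pb n k p ha hb.
  by congr pair => /=; rewrite ?(Lc _ _ _ _ _ _ _ ha hb) ?(Lc' _ _ _ _ _ _ _ ha hb).
Qed.

(* The intertwiner to N is the submodule of M * N generated by the pairs
   (iota x, f x): it is a graph because a nonzero element (0, y) would yield
   a nonzero singular vector (0, y'), that is (iota x, f x) with iota x = 0. *)
Lemma generated_induced (X : lmodType CC) (sX : X -> X) (M : lmodType CC)
    (sM : M -> M) (act : H -> int -> M -> M) (iota : X -> M) :
  is_twmod sH B sM act -> is_even_lin sX sM iota ->
  (forall x, singular act (iota x)) -> injective iota ->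
  (forall v, generated act iota v) ->
  is_induced sH B sX sM act iota.
Proof.
move=> modM even_i sing_i inj_i genM; have [lin_i par_i] := even_i.
split=> // [a n x n0|N sN actN f modN even_f sing_f].
  by have /singularP := sing_i x; apply.
have [lin_f par_f] := even_f.
have modP := twmod_prod modM modN.
pose jota (x : X) : M * N := (iota x, f x).
have lin_j : is_linear jota.
  by move=> c x y; congr pair => /=; rewrite ?lin_i ?lin_f.
have sing_j x : singular (act_prod act actN) (jota x).
  by move=> a n; congr pair; [exact: sing_i|exact: sing_f].
pose G := generated (act_prod act actN) jota.
have G0 y : G (0, y) -> y = 0.
  move=> Gy; have [d] : exists d, killed_by (act_prod act actN) d (0, y).
    exact: bounded_at_killed (generated_bounded formB modP sing_j Gy).
  elim: d y Gy => [|d IH] y Gy; first by case.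
  move=> [yd _].
  (* Each [actN a n y] has a smaller bound, so it vanishes by induction. *)
  have sy : singular (act_prod act actN) (0, y).
    move=> a n; have e0 := is_linear0 (act_lin modM a n).
    have aE : act_prod act actN a n (0, y) = (0, actN a n y).
      by rewrite /act_prod /= e0.
    rewrite aE (IH (actN a n y)) // -?aE //; last exact: yd.
    exact: gen_act.
  have [J [u [w [par [hu hw uE wE]]]]] := dual_homog_families formB.
  have [x [ix ->]] := generated_singular formB hu hw uE wE modP lin_j sing_j Gy sy.
  suff -> : x = 0 by apply: is_linear0.
  by apply: inj_i; rewrite -ix (is_linear0 lin_i).
have Gfun v y y' : G (v, y) -> G (v, y') -> y = y'.
  move=> Gy Gy'; apply/eqP; rewrite -subr_eq0; apply/eqP; apply: G0.
  have := gen_lin (-1) Gy' Gy; rewrite -/G.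
  suff -> : -1 *: (v, y') + (v, y) = (0, y - y') by [].
  by congr pair => /=; rewrite !scaleN1r addrC ?subrr.
have [g gP] : {g & forall v, G (v, g v)}.
  suff /choice : forall v, exists y, G (v, y) by [].
  move=> v; elim: {v}(genM v) => [x|c v v' _ [y Gy] _ [y' Gy']|a n v _ [y Gy]].
  - by exists (f x); apply: (gen_in _ jota).
  - by exists (c *: y + y'); apply: (gen_lin c Gy Gy').
  - by exists (actN a n y); apply: (gen_act a n Gy).
have gi x : g (iota x) = f x.
  by apply: (Gfun (iota x)) => //; apply: (gen_in _ jota).
have [lin_g par_g act_g] : is_twhom sM act sN actN g.
  split.
  - move=> c v v'; apply: (Gfun (c *: v + v')) => //.
    exact: (gen_lin c (gP v) (gP v')).
  - move=> v; apply: (Gfun (sM v)) => //.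
    have par_j x : jota (sX x) = (sM (iota x), sN (f x)).
      by rewrite /jota par_i par_f.
    exact: (generated_parity modP par_j (gP v)).
  - move=> a n v; apply: (Gfun (act a n v)) => //.
    exact: (gen_act a n (gP v)).
exists g; split=> // g' [lin_g' _ act_g'] g'i v.
elim: {v}(genM v) => [x|c v v' _ IH _ IH'|a n v _ IH].
- by rewrite g'i gi.
- by rewrite lin_g' lin_g IH IH'.
- by rewrite act_g' act_g IH.
Qed.

End Universal.

(** * The Fock space model *)

Lemma mode_Negz (n : nat) : mode (Negz n) = - mode n.
Proof.
rewrite /mode NegzE mulrNz -addn1 PoszD intrD opprD -addrA opprD; congr (_ + _).
by rewrite {1}[1%:~R]splitr div1r opprD subrK.
Qed.
(* A Fock space model: X-valued functions on words in letters (j, n), to be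
   thought of as f(p_1 ... p_L) = the X-component of A_{p_L} ... A_{p_1} f for
   annihilators A_p.  Annihilators act by translation and the creators are
   then determined by the canonical commutation relations. *)
Section Fock.
Variables (H : vectType CC) (sH : H -> H) (B : H -> H -> CC).
Hypothesis formB : is_super_form sH B.
Variables (J : finType) (u w : J -> H) (par : J -> bool).
Hypothesis hu : forall j, homog sH (par j) (u j).
Hypothesis hw : forall j, homog sH (par j) (w j).
Hypothesis uE : forall a, a = \sum_j B (w j) a *: u j.
Variables (X : lmodType CC) (sX : X -> X).
Hypothesis svX : is_svect sX.

Let word := seq (J * nat).
Let V : lmodType CC := word -> X.

Definition letter_sign (p q : J * nat) : CC := (-1) ^+ (par p.1 && par q.1).

Definition fock_ann (q : J * nat) (f : word -> X) : word -> X := fun t => f (q :: t).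

(** The value at [p :: t'] is that of [fock_ann p (fock_cre q f)] at [t'], so the recursion is the
    commutation relation itself. The value 0 at the empty word says that a created state has no
    vacuum component. *)
Fixpoint fock_cre (q : J * nat) (f : word -> X) (t : word) : X :=
  if t is p :: t' then
    (if p == q then f t' else 0) + letter_sign p q *: fock_cre q (fock_ann p f) t'
  else 0.

Definition word_sign (t : word) : CC := foldr (fun p c => (-1) ^+ par p.1 * c) 1 t.

Definition fock_parity (f : word -> X) : word -> X :=
  fun t => word_sign t *: sX (f t).

(** This makes the annihilators supercommute; the relations involving creators hold for all
    functions. *)
Definition supersymmetric (f : word -> X) := forall s p q t,
  f (s ++ p :: q :: t) = letter_sign p q *: f (s ++ q :: p :: t).

Definition fock_op (n : int) (j : J) : (word -> X) -> word -> X :=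
  match n with Posz n => fock_ann (j, n) | Negz n => fock_cre (j, n) end.

(** Creators carry the coordinates of [a] along [u], annihilators the pairing with [u j] and the
    whole factor [mode n], so that by [uE] the central term sums to [mode n * B a b]. *)
Definition fock_coef (a : H) (n : int) (j : J) : CC :=
  match n with Posz n => mode n * B a (u j) | Negz _ => B (w j) a end.

Definition fock_act (a : H) (n : int) (f : V) : V :=
  \sum_j fock_coef a n j *: (fock_op n j f : V).

Definition fock_vac (x : X) : V := fun t => if t is [::] then x else 0.

Lemma letter_signC p q : letter_sign p q = letter_sign q p.
Proof. by rewrite /letter_sign andbC. Qed.

Lemma letter_signK p q : letter_sign p q * letter_sign p q = 1.
Proof. by rewrite /letter_sign -signr_addb addbb. Qed.

Lemma word_signK t : word_sign t * word_sign t = 1.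
Proof.
elim: t => [|p t IH] /=; first by rewrite mulr1.
by rewrite mulrACA IH mulr1 -signr_addb addbb.
Qed.

Lemma fock_linE c (f g : V) t : (c *: f + g) t = c *: f t + g t.
Proof. by []. Qed.

Lemma fock_scaleE c (f : V) t : (c *: f) t = c *: f t.
Proof. by []. Qed.

Lemma fock_cre_lin q : is_linear (fock_cre q : V -> V).
Proof.
move=> c f g; apply/funext => t; rewrite fock_linE.
elim: t f g => [|p t IH] f g /=; first by rewrite scaler0 addr0.
rewrite (IH (fock_ann p f) (fock_ann p g)) fock_linE.
rewrite !scalerDr !scalerA [letter_sign _ _ * c]mulrC addrACA; congr (_ + _).
by case: eqP; rewrite ?scaler0 ?addr0.
Qed.

Lemma fock_op_lin n j : is_linear (fock_op n j : V -> V).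
Proof. by case: n => n //; apply: fock_cre_lin. Qed.

Lemma fock_ann_cre p q (f : V) : fock_ann p (fock_cre q f) =
  letter_sign p q *: (fock_cre q (fock_ann p f) : V) + (p == q)%:R *: f.
Proof.
apply/funext => t; rewrite fock_linE fock_scaleE addrC /fock_ann /=.
by congr (_ + _); case: eqP; rewrite ?scale1r ?scale0r.
Qed.

(** Induction on the word: reading its first letter [p] moves [fock_ann p] past both creators, and
    the two delta terms exchange roles. *)
Lemma fock_cre_cre q r (f : V) : fock_cre q (fock_cre r f) =
  letter_sign q r *: (fock_cre r (fock_cre q f) : V).
Proof.
apply/funext => t; rewrite fock_scaleE.
elim: t f => [|p t IH] f /=; first by rewrite scaler0.
rewrite !fock_ann_cre !fock_cre_lin !(is_linearZ (fock_cre_lin _)) !fock_linE.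
rewrite !fock_scaleE IH !scalerDr !scalerA.
set cq := fock_cre q f t; set cr := fock_cre r f t; set z := fock_cre r _ t.
rewrite [letter_sign p q * (_ * _)]mulrC [letter_sign p r * _]mulrC.
rewrite [LHS]addrCA [RHS]addrCA; congr (_ + _); rewrite addrC; congr (_ + _).
  case: eqP => [->|_]; last by rewrite mulr0 scale0r scaler0.
  by rewrite mulr1 [letter_sign r q]letter_signC.
case: eqP => [->|_]; last by rewrite mulr0 scale0r.
by rewrite mulr1 letter_signK scale1r.
Qed.

Lemma fock_parity_op n j (f : V) : fock_parity (fock_op n j (fock_parity f)) =
  (-1) ^+ par j *: (fock_op n j f : V).
Proof.
have [lin_s sK] := svX.
apply/funext => t; rewrite fock_scaleE; case: n => n /=; rewrite /fock_parity.
  rewrite /fock_ann /= (is_linearZ lin_s) sK scalerA mulrCA word_signK mulr1 //.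
elim: t f => [|p t IH] f /=; first by rewrite (is_linear0 lin_s) !scaler0.
have -> : fock_ann p (fock_parity f) =
    (-1) ^+ par p.1 *: (fock_parity (fock_ann p f) : V).
  by apply/funext => s; rewrite fock_scaleE /fock_parity /fock_ann /= scalerA.
rewrite (is_linearZ (fock_cre_lin _)) fock_scaleE.
rewrite (is_linearD lin_s) !(is_linearZ lin_s) !scalerDr !scalerA.
have := IH (fock_ann p f); set sg := word_sign t; set c := sX _ => cE.
have -> : (-1) ^+ par p.1 * sg * (letter_sign p (j, n) * (-1) ^+ par p.1)
    = letter_sign p (j, n) * sg.
  by rewrite [_ * (-1) ^+ _]mulrC mulrACA -signr_addb addbb mul1r mulrC.
rewrite -[X in _ + X = _]scalerA cE scalerA [letter_sign _ _ * _]mulrC.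
congr (_ + _); case: eqP => [->|_]; last by rewrite (is_linear0 lin_s) !scaler0.
by rewrite (is_linearZ lin_s) sK scalerA -mulrA word_signK mulr1.
Qed.

Lemma supersymmetric_lin c (f g : V) : supersymmetric f -> supersymmetric g ->
  supersymmetric (c *: f + g : V).
Proof.
move=> sf sg s p q t; rewrite !fock_linE sf sg scalerDr !scalerA.
by rewrite [c * _]mulrC.
Qed.

Lemma supersymmetric_ann q f : supersymmetric f -> supersymmetric (fock_ann q f).
Proof. by move=> sf s; apply: (sf (q :: s)). Qed.

Lemma supersymmetric_cre q f : supersymmetric f -> supersymmetric (fock_cre q f).
Proof.
move=> sf s p r t; elim: s f sf => [|p' s IH] f sf /=; last first.
  rewrite sf IH; last exact: supersymmetric_ann.
  rewrite scalerDr !scalerA [letter_sign p' q * _]mulrC; congr (_ + _).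
  by case: eqP; rewrite ?scaler0.
(* Once the prefix is stripped, the exchanged letters act as two annihilators on [f], whose order is
   reversed by the supersymmetry of [f]. *)
have -> : fock_ann r (fock_ann p f) =
    letter_sign p r *: (fock_ann p (fock_ann r f) : V).
  by apply/funext => s; rewrite fock_scaleE; apply: (sf [::]).
rewrite (is_linearZ (fock_cre_lin _)) fock_scaleE /fock_ann !scalerDr !scalerA.
rewrite [RHS]addrCA; congr (_ + (_ + _)).
- case: eqP => [->|_]; last by rewrite scaler0.
  by rewrite [letter_sign r q]letter_signC letter_signK scale1r.
- by case: eqP => [->|_]; rewrite ?scaler0.
- congr (_ *: _); rewrite [LHS]mulrC -[RHS]mulrA; congr (_ * _) => //.
  by rewrite mulrC.
Qed.

Lemma supersymmetric_op n j f : supersymmetric f -> supersymmetric (fock_op n j f).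
Proof. by case: n => n; [exact: supersymmetric_ann|exact: supersymmetric_cre]. Qed.

Lemma supersymmetric0 : supersymmetric (0 : V).
Proof. by move=> s p q t; rewrite scaler0. Qed.

Lemma supersymmetric_act a n f : supersymmetric f -> supersymmetric (fock_act a n f).
Proof.
move=> sf; apply: (big_ind (supersymmetric : V -> Prop)) => [|f1 f2 s1 s2|j _].
- exact: supersymmetric0.
- by rewrite -[f1]scale1r; apply: supersymmetric_lin.
- rewrite -[_ *: _]addr0; apply: supersymmetric_lin; last exact: supersymmetric0.
  exact: supersymmetric_op.
Qed.

Lemma supersymmetric_vac x : supersymmetric (fock_vac x).
Proof. by case=> [|p' s] p q t /=; rewrite scaler0. Qed.

Lemma fock_act_lin a n : is_linear (fock_act a n).
Proof.
move=> c f g; rewrite /fock_act scaler_sumr -big_split; apply: eq_bigr => j _ /=.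
by rewrite fock_op_lin scalerDr !scalerA [c * _]mulrC.
Qed.

Lemma fock_act_linl n f : is_linear (fun a => fock_act a n f).
Proof.
move=> c a b; rewrite /fock_act scaler_sumr -big_split; apply: eq_bigr => j _ /=.
rewrite scalerA -scalerDl; congr (_ *: _); case: n => n /=.
  by rewrite (form_linl formB) mulrDr; congr (_ + _); rewrite mulrCA.
by rewrite (form_linr formB).
Qed.

Lemma fock_parity_lin : is_linear (fock_parity : V -> V).
Proof.
move=> c f g; apply/funext => t; rewrite fock_linE /fock_parity fock_linE.
by have [-> _] := svX; rewrite scalerDr !scalerA mulrC.
Qed.

Lemma fock_parityK f : fock_parity (fock_parity f) = f.
Proof.
have [lin_s sK] := svX; apply/funext => t.
by rewrite /fock_parity (is_linearZ lin_s) sK scalerA word_signK scale1r.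
Qed.

Lemma fock_parity_act a n f :
  fock_parity (fock_act a n (fock_parity f)) = fock_act (sH a) n f.
Proof.
rewrite /fock_act (is_linear_sum fock_parity_lin); apply: eq_bigr => j _.
rewrite (is_linearZ fock_parity_lin) fock_parity_op scalerA; congr (_ *: _).
case: n => n /=.
  rewrite (form_even formB) hu (is_linearZ (form_linr formB _)) /GRing.scale /=.
  by rewrite mulrC mulrCA.
rewrite -(form_even formB) hw (is_linearZ (form_linl formB _)) /GRing.scale /=.
by rewrite mulrC.
Qed.

Lemma fock_coef_homog p a n j : homog sH p a -> p != par j -> fock_coef a n j = 0.
Proof.
move=> ha pj; case: n => n /=.
  by rewrite (form_homog formB ha (hu j)) // mulr0.
by rewrite (form_homog formB (hw j) ha) // eq_sym.
Qed.

Section FockCommutator.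
Variables (pa pb : bool) (a b : H).
Hypotheses (ha : homog sH pa a) (hb : homog sH pb b).

(** Coefficients vanish unless the label has the parity of the vector, so the signs of the labels
    can be replaced by the single sign of [a] and [b]. *)
Lemma fock_comm n k (c : J -> J -> CC) (f : V) :
  (forall j l, fock_op n j (fock_op k l f) =
     (-1) ^+ (par j && par l) *: (fock_op k l (fock_op n j f) : V) + c j l *: f) ->
  fock_act a n (fock_act b k f)
    - (-1) ^+ (pa && pb) *: fock_act b k (fock_act a n f)
  = (\sum_j \sum_l fock_coef a n j * fock_coef b k l * c j l) *: f.
Proof.
move=> Lc; rewrite scaler_suml.
have -> : fock_act a n (fock_act b k f) = \sum_j \sum_l
    (fock_coef a n j * fock_coef b k l) *: (fock_op n j (fock_op k l f) : V).
  apply: eq_bigr => j _; rewrite (is_linear_sum (fock_op_lin _ _)) scaler_sumr.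
  by apply: eq_bigr => l _; rewrite (is_linearZ (fock_op_lin _ _)) scalerA.
have -> : fock_act b k (fock_act a n f) = \sum_j \sum_l
    (fock_coef a n j * fock_coef b k l) *: (fock_op k l (fock_op n j f) : V).
  rewrite exchange_big /=; apply: eq_bigr => l _.
  rewrite (is_linear_sum (fock_op_lin _ _)) scaler_sumr.
  by apply: eq_bigr => j _; rewrite (is_linearZ (fock_op_lin _ _)) scalerA mulrC.
rewrite scaler_sumr -sumrB; apply: eq_bigr => j _.
rewrite scaler_suml scaler_sumr -sumrB; apply: eq_bigr => l _.
have [pj|pj] := eqVneq pa (par j); last first.
  by rewrite (fock_coef_homog n ha pj) !mul0r !scale0r scaler0 subrr.
have [pl|pl] := eqVneq pb (par l); last first.
  by rewrite (fock_coef_homog k hb pl) mulr0 mul0r !scale0r scaler0 subrr.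
by rewrite Lc pj pl scalerDr !scalerA [_ * (-1) ^+ _]mulrC addrC addKr.
Qed.

Lemma fock_comm_ann_ann (n k : nat) (f : V) : supersymmetric f ->
  fock_act a n (fock_act b k f)
    - (-1) ^+ (pa && pb) *: fock_act b k (fock_act a n f) = 0.
Proof.
move=> sf; rewrite (@fock_comm _ _ (fun _ _ => 0)) => [|j l].
  by rewrite big1 ?scale0r // => j _; rewrite big1 // => l _; rewrite mulr0.
rewrite scale0r addr0; apply/funext => t; rewrite fock_scaleE.
by rewrite andbC; apply: (sf [::]).
Qed.

Lemma fock_comm_cre_cre (n k : nat) (f : V) :
  fock_act a (Negz n) (fock_act b (Negz k) f)
    - (-1) ^+ (pa && pb) *: fock_act b (Negz k) (fock_act a (Negz n) f) = 0.
Proof.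
rewrite (@fock_comm _ _ (fun _ _ => 0)) => [|j l].
  by rewrite big1 ?scale0r // => j _; rewrite big1 // => l _; rewrite mulr0.
by rewrite scale0r addr0; apply: fock_cre_cre.
Qed.

Lemma fock_comm_ann_cre (n k : nat) (f : V) :
  fock_act a n (fock_act b (Negz k) f)
    - (-1) ^+ (pa && pb) *: fock_act b (Negz k) (fock_act a n f)
  = (if n == k then mode n * B a b else 0) *: f.
Proof.
rewrite (@fock_comm _ _ (fun j l => ((j, n) == (l, k))%:R)) => [|j l]; last first.
  exact: fock_ann_cre.
congr (_ *: _); case: eqP => [<-|/eqP nk]; last first.
  rewrite big1 // => j _; rewrite big1 // => l _.
  by rewrite xpair_eqE (negPf nk) andbF mulr0.
rewrite [in RHS](uE b) (is_linear_sum (form_linr formB _)) mulr_sumr.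
apply: eq_bigr => j _; rewrite (bigD1 j) //= eqxx mulr1 big1 ?addr0 => [|l lj].
  rewrite (is_linearZ (form_linr formB _)) /GRing.scale /= -mulrA.
  by congr (_ * _); rewrite mulrC.
by rewrite xpair_eqE eq_sym (negPf lj) mulr0.
Qed.

End FockCommutator.

Lemma fock_comm_act pa pb a b n k (f : V) :
  homog sH pa a -> homog sH pb b -> supersymmetric f ->
  fock_act a n (fock_act b k f)
    - (-1) ^+ (pa && pb) *: fock_act b k (fock_act a n f)
  = (if n + k + 1 == 0 then mode n * B a b else 0) *: f.
Proof.
move=> ha hb sf; case: n k => [] n [] k.
- by rewrite ann_ann_index scale0r (fock_comm_ann_ann ha hb).
- by rewrite ann_cre_index (fock_comm_ann_cre ha hb).
(* The opposite order follows by multiplying by minus the exchange sign; the supersymmetry of [B]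
   and [mode_Negz] then identify the central term. *)
- have /(congr1 (fun g : V => - (-1) ^+ (pa && pb) *: g)) := fock_comm_ann_cre hb ha k n f.
  rewrite scalerBr !scaleNr opprK scalerA andbC -signr_addb addbb scale1r addrC => ->.
  rewrite scalerA -scaleNr; congr (_ *: _).
  rewrite [Negz n + _]addrC ann_cre_index; case: eqP => [<-|_]; last by rewrite mulr0 oppr0.
  have [_ _ _ symB _] := formB; rewrite (symB _ _ _ _ hb ha).
  rewrite andbC mulrCA -mulNr mulrA -mulrA; congr (_ * _).
    exact/esym/mode_Negz.
  by rewrite mulrA -signr_addb addbb mul1r.
- by rewrite cre_cre_index scale0r (fock_comm_cre_cre ha hb).
Qed.

Lemma fock_vac_lin : is_linear fock_vac.
Proof. by move=> c x y; apply/funext => -[|p t] //; rewrite fock_linE /= scaler0 addr0. Qed.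

Lemma fock_vac_parity x : fock_vac (sX x) = fock_parity (fock_vac x).
Proof.
have [lin_s _] := svX; apply/funext => -[|p t]; rewrite /fock_parity /=.
  by rewrite scale1r.
by rewrite (is_linear0 lin_s) scaler0.
Qed.

Lemma fock_vac_singular x : singular fock_act (fock_vac x).
Proof. by move=> a n; rewrite /fock_act big1 // => j _; apply/funext => t; rewrite scaler0. Qed.

Lemma fock_vac_inj : injective fock_vac.
Proof. by move=> x y /(congr1 (fun f : V => f [::])). Qed.

(** The module is the part of the function space generated by the vacua. All its elements are
    supersymmetric, so the full commutation relations hold there; operators are restricted along the
    inclusion by choice. *)
Lemma generated_module_exists : exists (M : lmodType CC) (sM : M -> M)
    (act : H -> int -> M -> M) (iota : X -> M),
  [/\ is_twmod sH B sM act, is_even_lin sX sM iota,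
      (forall x, singular act (iota x)), injective iota &
      forall v, generated act iota v].
Proof.
pose P : V -> Prop := generated fock_act fock_vac.
have P0 : P 0.
  rewrite -[0](subrr (fock_vac 0)) -scaleN1r addrC.
  by apply: gen_lin; apply: gen_in.
have Plin c f g : P f -> P g -> P (c *: f + g) by apply: gen_lin.
have Psym f : P f -> supersymmetric f.
  elim=> [x|c f1 f2 _ s1 _ s2|a n f1 _ s1].
  - exact: supersymmetric_vac.
  - exact: supersymmetric_lin.
  - exact: supersymmetric_act.
have Ppar f : P f -> P (fock_parity f).
  elim=> [x|c f1 f2 _ P1 _ P2|a n f1 _ P1].
  - by rewrite -fock_vac_parity; apply: gen_in.
  - by rewrite fock_parity_lin; apply: gen_lin.
  - by rewrite -{1}[f1]fock_parityK fock_parity_act; apply: gen_act.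
have [S [i [lin_i inj_i imP]]] := subspace_exists P0 Plin.
have iP s : P (i s) by apply/imP; exists s.
have lift (T : Type) (f : T -> V) : (forall t, P (f t)) ->
    {g : T -> S & forall t, i (g t) = f t}.
  by move=> Pf; suff /choice : forall t, exists s, i s = f t by []; move=> t; apply/imP.
have [sS sSP] := lift _ (fun s => fock_parity (i s)) (fun s => Ppar _ (iP s)).
have [aS aSP] := lift (H * int * S)%type (fun q => fock_act q.1.1 q.1.2 (i q.2))
  (fun q => gen_act q.1.1 q.1.2 (iP q.2)).
have [iS iSP] := lift _ fock_vac (fun x => gen_in _ fock_vac x).
pose act a n s := aS (a, n, s).
have actP a n s : i (act a n s) = fock_act a n (i s) by apply: aSP.
have iB s s' : i (s - s') = i s - i s' by rewrite (is_linearB lin_i).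
have iZ c s : i (c *: s) = c *: i s by rewrite (is_linearZ lin_i).
exists S, sS, act, iS; split.
- split.
  + split=> [c s s'|s]; apply: inj_i; last by rewrite !sSP fock_parityK.
    by rewrite lin_i !sSP lin_i fock_parity_lin.
  + by move=> a n c s s'; apply: inj_i; rewrite lin_i !actP lin_i fock_act_lin.
  + move=> c a b n s; apply: inj_i; rewrite lin_i !actP.
    exact: (fock_act_linl n (i s) c a b).
  + by move=> a n s; apply: inj_i; rewrite sSP !actP sSP fock_parity_act.
  + move=> a b pa pb n k s ha hb; apply: inj_i.
    by rewrite iB !iZ !actP (fock_comm_act _ _ ha hb) //; apply: Psym.
- split=> [c x y|x]; apply: inj_i; first by rewrite lin_i !iSP fock_vac_lin.
  by rewrite sSP !iSP fock_vac_parity.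
- move=> x a n; apply: inj_i.
  by rewrite actP iSP fock_vac_singular (is_linear0 lin_i).
- by move=> x y xy; apply: fock_vac_inj; rewrite -!iSP xy.
- move=> s; move: {-2}(i s) (iP s) (erefl (i s)) => f Pf.
  elim: Pf s => [x|c f1 f2 P1 IH1 P2 IH2|a n f1 P1 IH1] s.
  + by rewrite -iSP => /inj_i ->; apply: gen_in.
  + have /imP [s1 e1] := P1; have /imP [s2 e2] := P2.
    rewrite -e1 -e2 -lin_i => /inj_i ->.
    by apply: gen_lin; [apply: IH1|apply: IH2].
  + have /imP [s1 e1] := P1; rewrite -e1 -actP => /inj_i ->.
    by apply: gen_act; apply: IH1.
Qed.

End Fock.

(** * Induced modules and the equivalence *)

Section Induced.
Variables (H : vectType CC) (sH : H -> H) (B : H -> H -> CC).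
Hypothesis formB : is_super_form sH B.

Lemma generated_induced_exists (X : lmodType CC) (sX : X -> X) : is_svect sX ->
  exists (M : lmodType CC) (sM : M -> M) (act : H -> int -> M -> M) (iota : X -> M),
    [/\ is_induced sH B sX sM act iota, injective iota &
        forall v, generated act iota v].
Proof.
move=> svX; have [J [u [w [par [hu hw uE wE]]]]] := dual_homog_families formB.
have [M [sM [act [iota [modM even_i sing_i inj_i genM]]]]] :=
  generated_module_exists formB hu hw uE svX.
by exists M, sM, act, iota; split=> //; apply: generated_induced.
Qed.

Section OneModule.
Variables (X : lmodType CC) (sX : X -> X) (M : lmodType CC) (sM : M -> M).
Variables (act : H -> int -> M -> M) (iota : X -> M).
Hypothesis svX : is_svect sX.
Hypothesis indM : is_induced sH B sX sM act iota.

(** The two universal properties give maps [h] to the Fock model and [k] back, with [k (h v) = v] by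
    uniqueness. Injectivity is pulled back along [h], generation is pushed forward along [k]. *)
Lemma induced_generated_inj : injective iota /\ forall v, generated act iota v.
Proof.
have [M0 [sM0 [act0 [iota0 [ind0 inj0 gen0]]]]] := generated_induced_exists svX.
have [modM even_i sing_i univM] := indM.
have [mod0 even0 sing0 univ0] := ind0.
have [h [[lin_h par_h act_h] hi _]] := univM _ _ _ _ mod0 even0 sing0.
have [k [[lin_k par_k act_k] ki _]] := univ0 _ _ _ _ modM even_i sing_i.
split=> [x y xy|v]; first by apply: inj0; rewrite -!hi xy.
have [g [_ _ guniq]] := univM _ _ _ _ modM even_i sing_i.
have <- : k (h v) = v.
  have gid : g v = v by rewrite -(guniq id).
  rewrite -[RHS]gid; apply: (guniq (k \o h)) => [|x] /=; last by rewrite hi ki.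
  by split=> [c p q|p|a n p] /=;
    rewrite ?lin_h ?lin_k ?par_h ?par_k ?act_h ?act_k.
elim: (gen0 (h v)) => [x|c p q _ IHp _ IHq|a n p _ IHp].
- by rewrite ki; apply: gen_in.
- by rewrite lin_k; apply: gen_lin.
- by rewrite act_k; apply: gen_act.
Qed.

Lemma induced_singular v : singular act v -> exists x, v = iota x.
Proof.
have [modM [lin_i _] sing_i _] := indM; have [_ genM] := induced_generated_inj.
have [J [u [w [par [hu hw uE wE]]]]] := dual_homog_families formB.
apply: (generated_singular formB hu hw uE wE modM lin_i) => //.
by move=> x; apply/singularP => a n; apply: sing_i.
Qed.

Lemma induced_bounded : bounded_below act.
Proof.
have [modM _ sing_i _] := indM; have [_ genM] := induced_generated_inj.
apply/(bounded_below_at act) => v; apply: (generated_bounded formB modM _ (genM v)).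
by move=> x; apply/singularP => a n; apply: sing_i.
Qed.

End OneModule.

(** The space [X] of singular vectors is stable under parity, and [killed_by_ind] shows that it
    generates [M]; its inclusion is injective, so [generated_induced] applies. *)
Lemma bounded_below_induced (M : lmodType CC) (sM : M -> M)
    (act : H -> int -> M -> M) : is_twmod sH B sM act -> bounded_below act ->
  exists (X : lmodType CC) (sX : X -> X) (iota : X -> M),
    is_svect sX /\ is_induced sH B sX sM act iota.
Proof.
move=> modM bM; have actL := act_lin modM; have [[lin_s sK] _ _ _ _] := modM.
have S0 : singular act 0 by move=> a n; apply: (is_linear0 (actL _ _)).
have Slin c u v : singular act u -> singular act v -> singular act (c *: u + v).
  by move=> su sv a n; rewrite actL su sv scaler0 addr0.
have Spar v : singular act v -> singular act (sM v).
  move=> sv a n; have [[_ sHK] _ _ _ _] := formB.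
  by rewrite -[a]sHK -(parity_act modM) sv (is_linear0 lin_s).
have [X [i [lin_i inj_i imS]]] := subspace_exists S0 Slin.
have iS x : singular act (i x) by apply/imS; exists x.
have [sX sXP] : {sX : X -> X & forall x, i (sX x) = sM (i x)}.
  by suff /choice : forall x, exists y, i y = sM (i x) by [];
    move=> x; apply/imS/Spar.
exists X, sX, i; split.
  by split=> [c x y|x]; apply: inj_i; rewrite ?lin_i !sXP ?lin_i ?lin_s ?sK.
apply: generated_induced => // v.
have [d vd] := bounded_at_killed ((bounded_below_at act).1 bM v).
have [J [u [w [par [hu hw uE wE]]]]] := dual_homog_families formB.
apply: (killed_by_ind formB hu hw wE modM _ _ _ vd) => [c p q|a n p|p].
- exact: gen_lin.
- exact: gen_act.
- by case/imS => x <-; apply: gen_in.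
Qed.

End Induced.

(* Ind_tw : SVect -> Rep_{flat,1}(hat h_tw) is an equivalence of categories:
   (0) Ind_tw(X) exists for every super vector space X;
   (1) it lands in Rep_{flat,1} (bounded below; K = 1 is built in);
   (2) it is fully faithful: every even intertwiner Ind X -> Ind Y is
       id (x) f for a unique even linear f : X -> Y;
   (3) it is essentially surjective. *)
Theorem theorem2p8 (H : vectType CC) (sH : H -> H) (B : H -> H -> CC) :
  is_super_form sH B -> (exists a : H, a != 0) ->
  [/\ (forall (X : lmodType CC) (sX : X -> X), is_svect sX ->
         exists (M : lmodType CC) (sM : M -> M) (actM : H -> int -> M -> M)
                (iota : X -> M), is_induced sH B sX sM actM iota),
      (forall (X : lmodType CC) (sX : X -> X)
              (M : lmodType CC) (sM : M -> M) (actM : H -> int -> M -> M)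
              (iota : X -> M),
         is_svect sX -> is_induced sH B sX sM actM iota ->
         bounded_below actM),
      (forall (X : lmodType CC) (sX : X -> X)
              (M : lmodType CC) (sM : M -> M) (actM : H -> int -> M -> M)
              (iota : X -> M)
              (Y : lmodType CC) (sY : Y -> Y)
              (N : lmodType CC) (sN : N -> N) (actN : H -> int -> N -> N)
              (kappa : Y -> N),
         is_svect sX -> is_induced sH B sX sM actM iota ->
         is_svect sY -> is_induced sH B sY sN actN kappa ->
         forall g : M -> N, is_twhom sM actM sN actN g ->
         exists f : X -> Y,
           [/\ is_even_lin sX sY f,
               (forall x, g (iota x) = kappa (f x)) &
               (forall f' : X -> Y, is_even_lin sX sY f' ->
                  (forall x, g (iota x) = kappa (f' x)) ->
                  forall x, f' x = f x)]) &
      (forall (M : lmodType CC) (sM : M -> M) (actM : H -> int -> M -> M),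
         is_twmod sH B sM actM -> bounded_below actM ->
         exists (X : lmodType CC) (sX : X -> X)
                (N : lmodType CC) (sN : N -> N) (actN : H -> int -> N -> N)
                (iota : X -> N) (g : N -> M),
           [/\ is_svect sX, is_induced sH B sX sN actN iota,
               is_twhom sN actN sM actM g & bijective g])].
Proof.
move=> formB _; split.
- move=> X sX svX.
  have [M [sM [act [iota [indM _ _]]]]] := generated_induced_exists formB svX.
  by exists M, sM, act, iota.
- by move=> X sX M sM act iota svX indM; apply: (induced_bounded formB svX indM).
- move=> X sX M sM actM iota Y sY N sN actN kappa svX indM svY indN g [lin_g par_g act_g].
  have [modM [lin_i par_i] sing_i _] := indM.
  have [modN [lin_k par_k] sing_k _] := indN.
  have [inj_k _] := induced_generated_inj formB svY indN.
  (* An intertwiner sends singular vectors to singular vectors, and those of [N] all lie in the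
     image of [kappa]. *)
  have [f fP] : {f : X -> Y & forall x, g (iota x) = kappa (f x)}.
    suff /choice : forall x, exists y, g (iota x) = kappa y by [].
    move=> x; apply: (induced_singular formB svY indN) => a n.
    by rewrite -act_g sing_i // (is_linear0 lin_g).
  exists f; split=> // [|f' _ f'P x]; last by apply: inj_k; rewrite -f'P fP.
  split=> [c x y|x]; apply: inj_k; first by rewrite lin_k -!fP lin_i lin_g.
  by rewrite par_k -!fP par_i par_g.
- move=> M sM act modM bM.
  have [X [sX [iota [svX indM]]]] := bounded_below_induced formB modM bM.
  exists X, sX, M, sM, act, iota, id; split=> //.
  by exists id.
Qed.
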